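(* Let $\alpha$ be a peak composition of $n$. Then $$|\mathrm{SPIT}(\alpha)|=\frac{n!}{\prod_{c\in D(\alpha)}\tilde h_\alpha(c)}.$$
   Context: A composition $\alpha=(\alpha_1,\dots,\alpha_k)$ of $n$ is a finite list of positive integers with sum $n$; $\ell(\alpha)=k$. The diagram $D(\alpha)$ is the left-justified array with $\alpha_i$ boxes in row $i$, rows numbered from bottom to top; box $(i,j)$ lies in column $i$ and row $j$. A peak composition is a composition all of whose parts, except possibly the last, are greater than $1$. For a peak composition $\alpha$ of $n$, $\mathrm{SPIT}(\alpha)$ is the set of standard peak immaculate tableaux of shape $\alpha$: fillings of $D(\alpha)$ with $1,\dots,n$ (each once), rows increasing from left to right, first column increasing from bottom to top, such that for every $1\le k\le n$ the boxes with entries $\le k$ form the diagram of a peak composition. For a box $(i,j)\in D(\alpha)$: $$\tilde h_\alpha((i,j))=\begin{cases}\alpha_j+\alpha_{j+1}+\cdots+\alpha_{\ell(\alpha)} & i=1,\\ \alpha_j+\alpha_{j+1}+\cdots+\alpha_{\ell(\alpha)}-1 & i=2,\\ \alpha_j-i+1 & i\ge3.\end{cases}$$ *)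

(* Defs.v *)
From mathcomp Require Import all_boot.

Set Implicit Arguments.
Unset Strict Implicit.
Unset Printing Implicit Defensive.

(* Rows and columns are numbered from 1, so [part alpha j] is meant for
   1 <= j <= size alpha. *)
Definition part (alpha : seq nat) (j : nat) : nat := nth 0 alpha j.-1.

Definition is_composition (n : nat) (alpha : seq nat) : bool :=
  all (leq 1) alpha && (sumn alpha == n).

Definition is_peak_composition (n : nat) (alpha : seq nat) : bool :=
  is_composition n alpha && all (leq 2) (take (size alpha).-1 alpha).

(* The box (i, j) lies in column i and row j; row 1 is the bottom row. *)
Definition diagram (alpha : seq nat) : seq (nat * nat) :=
  [seq (i, j) | j <- iota 1 (size alpha), i <- iota 1 (part alpha j)].

Definition box (alpha : seq nat) : finType := seq_sub (diagram alpha).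
Definition col alpha (b : box alpha) : nat := (val b).1.
Definition row alpha (b : box alpha) : nat := (val b).2.

Section Tableaux.
Variables (n : nat) (alpha : seq nat).

(* Entries are stored shifted by one: 'I_n is {0, ..., n-1}, the actual
   entry of [T] in the box [b] is [entry T b], in {1, ..., n}. *)
Definition filling := {ffun box alpha -> 'I_n}.
Definition entry (T : filling) (b : box alpha) : nat := (T b).+1.

Definition each_entry_once (T : filling) : bool :=
  [forall m : 'I_n, #|[set b | entry T b == m.+1]| == 1].

Definition rows_increasing (T : filling) : bool :=
  [forall b, forall b', (row b == row b') && (col b < col b')
                        ==> (entry T b < entry T b')].

Definition first_column_increasing (T : filling) : bool :=
  [forall b, forall b', [&& col b == 1, col b' == 1 & row b < row b']
                        ==> (entry T b < entry T b')].

Definition boxes_upto (T : filling) (k : nat) : seq (nat * nat) :=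
  [seq val b | b <- enum {: box alpha} & entry T b <= k].

(* For k <= n, bounding the length and the parts of beta by n loses nothing:
   see [upto_is_peakP]. *)
Definition upto_is_peak (T : filling) (k : nat) : bool :=
  [exists r : 'I_n.+1, exists beta : r.-tuple 'I_n.+1,
     is_peak_composition k (map val beta)
     && perm_eq (boxes_upto T k) (diagram (map val beta))].

Definition is_SPIT (T : filling) : bool :=
  [&& each_entry_once T, rows_increasing T, first_column_increasing T
    & all (upto_is_peak T) (iota 1 n)].

Definition SPIT : {set filling} := [set T | is_SPIT T].

End Tableaux.

Definition peak_hook (alpha : seq nat) (c : nat * nat) : nat :=
  let: (i, j) := c in
  let tail := \sum_(j <= m < (size alpha).+1) part alpha m in
  if i == 1 then tail
  else if i == 2 then tail - 1
  else part alpha j - i + 1.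

Lemma diagram_uniq alpha : uniq (diagram alpha).
Proof.
apply: allpairs_uniq_dep; first exact: iota_uniq.
  by move=> j _; exact: iota_uniq.
by move=> [j i] [j' i'] _ _ /= [-> ->].
Qed.

Lemma boxes_upto_uniq n alpha (T : filling n alpha) k : uniq (boxes_upto T k).
Proof. by rewrite map_inj_uniq; [rewrite filter_uniq ?enum_uniq|exact: val_inj]. Qed.

Lemma upto_is_peakP n alpha (T : filling n alpha) k : k <= n ->
  reflect (exists2 beta, is_peak_composition k beta
                       & boxes_upto T k =i diagram beta)
          (upto_is_peak T k).
Proof.
move=> kn; apply: (iffP existsP) => [[r /existsP[beta /andP[pb /perm_mem eb]]]|].
  by exists (map val beta).
move=> [beta pb eb].
have /andP[/andP[pos /eqP sb] _] := pb.
have szb : size beta < n.+1.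
  rewrite ltnS (leq_trans _ kn) // -sb; elim: beta pos {pb eb sb} => //= x s IH.
  by case/andP=> x0 /IH; rewrite -[(size s).+1]add1n; exact: leq_add.
have bnd x : x \in beta -> x < n.+1.
  move=> xb; rewrite ltnS (leq_trans _ kn) // -sb.
  elim: beta xb {pb eb sb szb pos} => //= y s IH; rewrite inE => /orP[/eqP->|/IH].
    exact: leq_addr.
  by move=> /leq_trans; apply; exact: leq_addl.
have sz : size (map (@inord n) beta) == Ordinal szb by rewrite size_map.
exists (Ordinal szb); apply/existsP; exists (Tuple sz) => /=.
have -> : map val (map (@inord n) beta) = beta.
  rewrite -map_comp -[RHS]map_id; apply/eq_in_map => x /bnd xn /=.
  by rewrite inordK.
by rewrite pb uniq_perm ?boxes_upto_uniq ?diagram_uniq.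
Qed.

(* Main.v *)
(** The tableaux in [SPIT alpha] are the linear extensions of a rooted tree on
the boxes: each box of a row is the parent of its right neighbour, and box
(2, j) is also the parent of box (1, j + 1); the peak condition is what places
the entry of (2, j) before that of (1, j + 1).  The numbers [peak_hook alpha c]
are the sizes of the subtrees, so the claim is the hook length formula for
trees.  To get the latter, impose the conditions "x carries the minimum of its
subtree" one x at a time, parents first.  The conditions imposed so far do not
distinguish the elements of the subtree of x, so exchanging the entries of two
of them shows that the minimum is equally likely to be at each of them; hence
the condition at x divides the number of fillings by the size of the subtree. *)
Require Import Defs.
From mathcomp Require Import all_boot all_order all_algebra all_fingroup.
From mathcomp Require Import zify.

Set Implicit Arguments.
Unset Strict Implicit.
Unset Printing Implicit Defensive.

(* Again, since [row] and [col] are shadowed by those of matrices. *)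
Import Defs GRing.Theory.

(** * Hook length formula by exchanging entries *)

Section HookLengthFormula.
Variables (X : finType) (n : nat) (desc : X -> {set X}).
Implicit Types (f : {ffun X -> 'I_n}) (x y : X) (s : seq X).

Definition min_at f (A : {set X}) x := [forall y in A, f x <= f y].

(** The list [s] records where the minimum condition has been imposed so far; the empty list leaves
    all injections. *)
Definition heaps s : {set {ffun X -> 'I_n}} :=
  [set f : {ffun X -> 'I_n} | injectiveb f & all (fun x => min_at f (desc x) x) s].

(** The tree structure enters only through this relation: [x] may precede [y] if it is not a
    descendant of [y] and the two descendant sets are nested, in this order, or disjoint. *)
Definition parents_first x y :=
  (x \notin desc y) && ((desc y \subset desc x) || [disjoint desc y & desc x]).

Definition swap x y f : {ffun X -> 'I_n} := [ffun z => f (tperm x y z)].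

Lemma swapK x y : involutive (swap x y).
Proof. by move=> f; apply/ffunP => z; rewrite !ffunE tpermK. Qed.

Lemma swap_inj x y f : injective f -> injective (swap x y f).
Proof. by move=> fI z t; rewrite !ffunE => /fI /perm_inj. Qed.

Lemma tperm_stable (A : {set X}) x y z : (x \in A) = (y \in A) ->
  (tperm x y z \in A) = (z \in A).
Proof. by move=> xy; case: tpermP => [->|->|]. Qed.

Lemma min_at_swap x y f (A : {set X}) z : (x \in A) = (y \in A) ->
  min_at (swap x y f) A z = min_at f A (tperm x y z).
Proof.
move=> xy; apply/forall_inP/forall_inP => h t tA.
  by have := h (tperm x y t); rewrite !ffunE tpermK tperm_stable //; apply.
by rewrite !ffunE h // tperm_stable.
Qed.

(** Each [z] in [s] lies outside [desc x], so the transposition fixes it, and [desc z] contains both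
    of [x] and [y] or neither. *)
Lemma swap_heaps s x y f : all (parents_first^~ x) s ->
  x \in desc x -> y \in desc x -> f \in heaps s -> swap x y f \in heaps s.
Proof.
move=> sx xx yx; rewrite !inE => /andP[/injectiveP fI fs].
apply/andP; split; first exact/injectiveP/swap_inj.
apply/allP => z zs; have /andP[zx lam] := allP sx z zs.
rewrite min_at_swap.
  rewrite tpermD; first exact: (allP fs).
    by apply: contraNneq zx => <-.
  by apply: contraNneq zx => <-.
case/orP: lam => [/subsetP h|/pred0P h]; first by rewrite !h.
have := h x; have := h y => /=; rewrite xx yx /= => -> //.
Qed.

Lemma card_min_at f (A : {set X}) x : injective f -> x \in A ->
  #|[set y in A | min_at f A y]| = 1.
Proof.
move=> fI xA; apply/eqP/cards1P.
case: (arg_minnP (fun y => val (f y)) xA) => y yA ymin.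
exists y; apply/setP => z; rewrite !inE; apply/andP/eqP => [[zA /forall_inP h]|->].
  by apply/fI/val_inj/eqP; rewrite eqn_leq h //= ymin.
by split=> //; apply/forall_inP.
Qed.

Lemma card_heaps_rcons s x : all (parents_first^~ x) s -> x \in desc x ->
  #|heaps (rcons s x)| * #|desc x| = #|heaps s|.
Proof.
move=> sx xx; rewrite -[RHS]sum1_card.
(* Double counting of the pairs of a filling [f] and the unique [y] where [f] is minimal on
   [desc x]. *)
transitivity (\sum_(f in heaps s) \sum_(y in desc x | min_at f (desc x) y) 1).
  rewrite (exchange_big_dep (mem (desc x))) /=; last by move=> f y _ /andP[].
  rewrite mulnC -sum_nat_const; apply: eq_bigr => y yx.
  (* Exchanging the entries at [x] and [y] moves the minimum from [y] to [x], so every [y]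
     contributes equally. *)
  rewrite (reindex_inj (inv_inj (swapK x y))) sum1_card.
  apply: eq_card => f; rewrite [RHS]inE min_at_swap ?xx ?yx // tpermR /=.
  have -> : (swap x y f \in heaps s) = (f \in heaps s).
    apply/idP/idP => [/(swap_heaps sx xx yx)|]; last exact: swap_heaps.
    by rewrite swapK.
  by rewrite !inE all_rcons; case: (injectiveb f); rewrite //= andbC.
apply: eq_bigr => f; rewrite inE => /andP[/injectiveP fI _].
rewrite sum1_card -(card_min_at fI xx); apply: eq_card => y.
by rewrite [RHS]inE.
Qed.

Theorem card_heaps s : (forall x, x \in desc x) -> pairwise parents_first s ->
  #|heaps s| * \prod_(x <- s) #|desc x| = n ^_ #|X|.
Proof.
move=> xx; elim/last_ind: s => [_|s x IH].
  rewrite big_nil muln1 -[n in RHS]card_ord -card_inj_ffuns.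
  by apply: eq_card => f; rewrite !inE andbT.
rewrite pairwise_rcons => /andP[sx /IH <-].
by rewrite big_rcons /= [X in _ * X]mulnC mulnA card_heaps_rcons.
Qed.

End HookLengthFormula.

(** * The tree on the boxes and the sizes of its subtrees *)

Definition below (c d : nat * nat) : bool :=
  ((d.2 == c.2) && (c.1 <= d.1)) || ((c.1 <= 2) && (c.2 < d.2)).

Definition lex (c d : nat * nat) : bool :=
  (c.2 < d.2) || ((c.2 == d.2) && (c.1 < d.1)).

(** In a peak composition, columns 1 and 2 reach every higher row through the links from (2, j) to
    (1, j + 1); from column 3 on, only the rest of the row remains. This gives the closed form
    [below]. *)
Definition subtree alpha (b : box alpha) : {set box alpha} :=
  [set b' | below (val b) (val b')].

Lemma lex_parents_first alpha (b b' : box alpha) :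
  lex (val b) (val b') -> parents_first (@subtree alpha) b b'.
Proof.
rewrite /parents_first /subtree inE /lex /below.
case: (val b) (val b') => [i j] [i' j'] /= bb'.
apply/andP; split; first lia.
(* In the remaining case the subtree of [b] stays within row [j], while that of [b'] starts in a
   higher row. *)
have [i3|i3] := boolP ((i <= 2) || (j == j')); apply/orP; [left | right].
  by apply/subsetP => d; rewrite !inE; case: (val d) => /= k l; lia.
by apply/pred0P => d /=; rewrite !inE; case: (val d) => /= k l; lia.
Qed.

Lemma pairwise_lex_diagram alpha : pairwise lex (diagram alpha).
Proof.
rewrite /diagram; move: (part alpha) => p.
have : pairwise ltn (iota 1 (size alpha)).
  by rewrite -(sorted_pairwise ltn_trans) iota_ltn_sorted.
elim: (iota _ _) => //= j s IH /andP[js /IH {}IH].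
rewrite pairwise_cat IH andbT; apply/andP; split.
  apply/allrelP => _ _ /mapP[i _ ->] /allpairsPdep[j' [i' [j's _ ->]]].
  by have := allP js _ j's; rewrite /lex /= => ->.
rewrite pairwise_map; apply: (@sub_pairwise _ ltn).
  by move=> i i' /= ii'; rewrite /lex /= eqxx ii' orbT.
by rewrite -(sorted_pairwise ltn_trans) iota_ltn_sorted.
Qed.

Lemma mem_diagram alpha i j : ((i, j) \in diagram alpha) =
  [&& 1 <= j, j <= size alpha, 1 <= i & i <= part alpha j].
Proof.
apply/allpairsPdep/idP => [[j' [i' [+ + [-> ->]]]]|]; rewrite ?mem_iota; first lia.
by move=> h; exists j, i; rewrite !mem_iota; split=> //; lia.
Qed.

Lemma size_diagram alpha : size (diagram alpha) = sumn alpha.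
Proof.
rewrite size_allpairs_dep; congr sumn.
apply: (@eq_from_nth _ 0) => [|i]; rewrite size_map size_iota // => ia.
by rewrite (nth_map 0) !size_iota // nth_iota.
Qed.

Lemma map_val_seq_sub_enum alpha :
  map val (seq_sub_enum (diagram alpha)) = diagram alpha.
Proof. exact/val_seq_sub_enum/diagram_uniq. Qed.

Lemma card_box_pred alpha (P : pred (nat * nat)) :
  #|[set b : box alpha | P (val b)]| = count P (diagram alpha).
Proof.
rewrite -[in RHS]map_val_seq_sub_enum count_map cardsE cardE /enum_mem size_filter.
have /seq.permP -> : perm_eq (Finite.enum (box alpha)) (seq_sub_enum (diagram alpha)).
  apply: uniq_perm; first by rewrite -enumT enum_uniq.
    by apply: (@map_uniq _ _ val); rewrite map_val_seq_sub_enum diagram_uniq.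
  by move=> b; rewrite -enumT mem_enum mem_seq_sub_enum.
by [].
Qed.

Lemma count_leq_iota i p : 0 < i -> count (leq i) (iota 1 p) = p.+1 - i.
Proof.
move=> i0; elim: p => [|p IH]; first by case: i i0.
by rewrite -[X in iota _ X]addn1 iotaD count_cat IH /= add1n; lia.
Qed.

Lemma count_below alpha c : c \in diagram alpha ->
  count (below c) (diagram alpha) = peak_hook alpha c.
Proof.
case: c => i j; rewrite mem_diagram => /and4P[j1 jl i1 ip].
(* [F j'] is the contribution of row [j'] to the subtree of [(i, j)]. *)
pose F j' := if j' == j then (part alpha j).+1 - i
  else if (i <= 2) && (j < j') then part alpha j' else 0.
have -> : count (below (i, j)) (diagram alpha)
    = \sum_(1 <= j' < (size alpha).+1) F j'.
  rewrite /index_iota subSS subn0 /diagram count_flatten sumnE !big_map.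
  apply: eq_bigr => j' _; rewrite count_map /F.
  have [->|jj'] := eqVneq j' j.
    rewrite -count_leq_iota //; apply: eq_count => i' /=.
    by rewrite /below /= eqxx ltnn andbF orbF.
  rewrite (eq_count (a2 := fun=> (i <= 2) && (j < j'))).
    by case: (_ && _); rewrite ?count_predT ?count_pred0 ?size_iota.
  by move=> i'; rewrite /below /= (negbTE jj').
rewrite (big_cat_nat (n := j)) //=; last lia.
rewrite big_nat big1 => [|j' jj']; last first.
  by rewrite /F ifF ?ifF //; lia.
rewrite add0n big_ltn // {1}/F eqxx /peak_hook (big_ltn (m := j)) //.
have -> : \sum_(j.+1 <= j' < (size alpha).+1) F j'
    = if i <= 2 then \sum_(j.+1 <= m < (size alpha).+1) part alpha m else 0.
  case: ifP => i2; last rewrite big_nat big1 //.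
    apply: eq_big_nat => j' jj'; rewrite /F ifF ?i2; last lia.
    by rewrite ifT //; lia.
  by move=> j' jj'; rewrite /F i2 ifF //; lia.
move: (\sum_(_ <= _ < _) _) => t.
(* The bound [ip] keeps the truncated subtractions exact. *)
by case: i i1 ip {F} => [|[|[|i]]] //= _ ip; lia.
Qed.

Lemma card_subtree alpha (b : box alpha) :
  #|subtree b| = peak_hook alpha (val b).
Proof. by rewrite card_box_pred count_below //; exact: valP. Qed.

Lemma card_box alpha : #|box alpha| = sumn alpha.
Proof. by rewrite card_seq_sub ?diagram_uniq // size_diagram. Qed.

(** * Subdiagrams closed under ancestors *)

Lemma iota_count_initial (P : pred nat) p :
  (forall i i', 1 <= i <= i' -> i' <= p -> P i' -> P i) ->
  forall i, 1 <= i <= p -> P i = (i <= count P (iota 1 p)).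
Proof.
elim: p => [|p IH] dP i ip; first lia.
rewrite -[X in iota _ X]addn1 iotaD count_cat /= add1n addn0.
have {}IH := IH (fun i i' h h' => dP i i' h (leqW h')).
have cp : count P (iota 1 p) <= p by rewrite -[X in _ <= X](size_iota 1 p) count_size.
case: (boolP (P p.+1)) => Pp /=.
  have -> : count P (iota 1 p) = p.
    rewrite -[RHS](size_iota 1 p); apply/eqP; rewrite -all_count.
    by apply/allP => k; rewrite mem_iota => kp; apply: (dP k p.+1) => //; lia.
  by rewrite (dP i p.+1) //; lia.
rewrite addn0; have [ip'|ip'] := leqP i p; first by apply: IH; lia.
have -> : i = p.+1 by lia.
by rewrite (negbTE Pp); lia.
Qed.

Lemma peak_part n alpha j : is_peak_composition n alpha ->
  1 <= j -> j < size alpha -> 2 <= part alpha j.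
Proof.
move=> /andP[_ /all_nthP h] j1 ja.
have /(h 0) : j.-1 < size (take (size alpha).-1 alpha) by rewrite size_takel; lia.
by rewrite nth_take //; lia.
Qed.

Lemma part_gt0 n alpha j : is_peak_composition n alpha ->
  1 <= j <= size alpha -> 1 <= part alpha j.
Proof. by move=> /andP[/andP[/all_nthP h _] _] ja; apply: h; lia. Qed.

Section Subdiagram.
Variables (n : nat) (alpha : seq nat) (D : pred (nat * nat)).
Hypothesis peak_alpha : is_peak_composition n alpha.
Hypothesis D_up : forall c d, c \in diagram alpha -> d \in diagram alpha ->
  below c d -> D d -> D c.

(** Closure under ancestors makes [D] meet the first column and each row in an initial segment, so
    counting recovers the number of rows and their lengths. *)
Let rows := count (fun j => D (1, j)) (iota 1 (size alpha)).
Let len j := count (fun i => D (i, j)) (iota 1 (part alpha j)).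
Let beta := [seq len j | j <- iota 1 rows].

Lemma rowsP j : 1 <= j <= size alpha -> D (1, j) = (j <= rows).
Proof.
apply: iota_count_initial => {}j j' jj' j'a.
have p := @part_gt0 _ _ j peak_alpha; have p' := @part_gt0 _ _ j' peak_alpha.
apply: D_up; rewrite ?mem_diagram ?[below _ _]/=; try lia.
by rewrite /below /=; lia.
Qed.

Lemma lenP i j : 1 <= j <= size alpha -> 1 <= i <= part alpha j ->
  D (i, j) = (i <= len j).
Proof.
move=> ja; apply: iota_count_initial => {}i i' ii' i'p.
by apply: D_up; rewrite ?mem_diagram /below /=; lia.
Qed.

Lemma rows_size : rows <= size alpha.
Proof. by rewrite -[X in _ <= X](size_iota 1) count_size. Qed.

Lemma len_part j : len j <= part alpha j.
Proof. by rewrite -[X in _ <= X](size_iota 1) count_size. Qed.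

Lemma part_beta j : 1 <= j <= rows -> part beta j = len j.
Proof.
move=> jr; rewrite /part (nth_map 0) ?size_iota; last lia.
by rewrite nth_iota; [congr len; lia | lia].
Qed.

Lemma subdiagram_mem c : (c \in diagram beta) = (c \in diagram alpha) && D c.
Proof.
case: c => i j; rewrite !mem_diagram size_map size_iota.
have rs := rows_size; have lp := len_part j.
have [jr|jr] := boolP (1 <= j <= rows).
  rewrite part_beta //; apply/idP/idP => [h|/andP[h]].
    by rewrite lenP; lia.
  by rewrite lenP; lia.
apply/idP/idP => [|/andP[h Dij]]; first lia.
(* The first box of a row is an ancestor of the whole row, so a row above [rows] cannot meet [D]. *)
have : D (1, j).
  apply: D_up Dij; rewrite ?mem_diagram //; first lia.
  by rewrite /below /=; lia.
by rewrite rowsP; lia.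
Qed.

Lemma subdiagram_peak :
  is_peak_composition (count D (diagram alpha)) beta.
Proof.
have rs := rows_size.
have len1 j : 1 <= j <= rows -> 1 <= len j.
  move=> jr; have p := @part_gt0 _ _ j peak_alpha.
  by rewrite -lenP ?rowsP; lia.
apply/andP; split; first (apply/andP; split).
- by apply/allP => _ /mapP[j + ->]; rewrite mem_iota => jr; apply: len1; lia.
- rewrite -size_diagram -size_filter; apply/eqP/perm_size.
  apply: uniq_perm; rewrite ?filter_uniq ?diagram_uniq // => c.
  by rewrite mem_filter andbC subdiagram_mem.
rewrite size_map size_iota -map_take; apply/allP => _ /mapP[j + ->].
rewrite take_iota mem_iota => jr.
have p2 := peak_part peak_alpha (j := j).
have p1 := @part_gt0 _ _ j.+1 peak_alpha.
rewrite -lenP; [|lia..].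
(* Row [j] is not the last row of [beta], so (1, j + 1) is in [D], and with it its parent (2, j). *)
apply: (D_up (d := (1, j.+1))); rewrite ?mem_diagram ?rowsP; try lia.
by rewrite /below /=; lia.
Qed.

Lemma subdiagramP :
  exists2 beta, is_peak_composition (count D (diagram alpha)) beta
              & diagram beta =i [pred c in diagram alpha | D c].
Proof. by exists beta; [exact: subdiagram_peak | exact: subdiagram_mem]. Qed.

End Subdiagram.

(** * Peak immaculate tableaux as heaps on the tree *)

Lemma card_ord_lt n k : k <= n -> #|[set m : 'I_n | m < k]| = k.
Proof.
move=> kn; rewrite -sum1dep_card -(big_ord_widen n (fun=> 1) kn).
by rewrite sum1_card card_ord.
Qed.

Section Characterization.
Variables (n : nat) (alpha : seq nat).
Hypothesis peak_alpha : is_peak_composition n alpha.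
Variable T : filling n alpha.

Lemma card_box_ord : #|'I_n| = #|box alpha|.
Proof. by have /andP[/andP[_ /eqP <-] _] := peak_alpha; rewrite card_box card_ord. Qed.

(** There are as many boxes as entries, so an injective filling is bijective. *)
Lemma each_entry_onceE : each_entry_once T = injectiveb T.
Proof.
apply/forallP/injectiveP => [once b b' bb'|TI m].
  have /cards1P[d dE] := once (T b).
  have : b \in [set d] by rewrite -dE inE.
  have : b' \in [set d] by rewrite -dE inE /entry -bb'.
  by rewrite !inE => /eqP -> /eqP ->.
have [|g _ gK] := inj_card_bij TI; first by rewrite card_box_ord.
apply/cards1P; exists (g m); apply/setP => b; rewrite !inE /entry eqSS.
apply/eqP/eqP => [/val_inj <-|->]; last by rewrite gK.
by apply: TI; rewrite gK.
Qed.

Lemma heapsP :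
  reflect (injective T /\ forall b b', below (val b) (val b') -> T b <= T b')
    (T \in heaps n (@subtree alpha) (seq_sub_enum (diagram alpha))).
Proof.
rewrite inE; apply: (iffP andP) => [[/injectiveP TI /allP h]|[TI h]].
  split=> // b b' bb'.
  have /forall_inP := h b (mem_seq_sub_enum b); apply.
  by rewrite inE.
split; first exact/injectiveP.
apply/allP => b _; apply/forall_inP => b'; rewrite inE; exact: h.
Qed.

Lemma box_of_mem c : c \in diagram alpha -> exists b : box alpha, val b = c.
Proof. by move=> cD; exists (SeqSub cD). Qed.

Lemma mem_boxes_upto k b : (val b \in boxes_upto T k) = (entry T b <= k).
Proof. by rewrite mem_map; [rewrite mem_filter mem_enum andbT|exact: val_inj]. Qed.

Lemma SPIT_min : is_SPIT T ->
  forall b b', below (val b) (val b') -> T b <= T b'.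
Proof.
case/and4P => + /forallP rowI /forallP colI /allP peakI.
rewrite each_entry_onceE => /injectiveP TI.
have row_le b b' : row b = row b' -> col b <= col b' -> T b <= T b'.
  rewrite leq_eqVlt => rr /orP[/eqP cc|cc].
    rewrite (_ : b = b') //; apply: val_inj; move: rr cc; rewrite /row /col.
    by case: (val b) (val b') => ? ? [? ?] /= -> ->.
  by apply: ltnW; have /implyP := forallP (rowI b) b'; rewrite rr eqxx; apply.
have col_le b b' : col b = 1 -> col b' = 1 -> row b <= row b' -> T b <= T b'.
  move=> cb cb'; rewrite leq_eqVlt => /orP[/eqP rr|rr].
    by apply: row_le; rewrite ?cb ?cb'.
  by apply: ltnW; have /implyP := forallP (colI b) b'; rewrite cb cb' rr; apply.
(* Box (2, j) precedes box (1, j + 1): when the latter is filled, row j is not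
   the last one of a peak composition, hence has at least two boxes. *)
have peak_le b b' : col b = 2 -> col b' = 1 -> row b' = (row b).+1 -> T b <= T b'.
  move=> cb cb' rr.
  have kn : entry T b' <= n by apply: ltn_ord.
  have /(upto_is_peakP _ kn)[beta pb eb] : upto_is_peak T (entry T b').
    by apply: peakI; rewrite mem_iota add1n ltnS.
  suff : val b \in diagram beta by rewrite -eb mem_boxes_upto /entry ltnS.
  have : val b' \in diagram beta by rewrite -eb mem_boxes_upto.
  have := valP b; move: cb cb' rr; rewrite /row /col.
  case: (val b) (val b') => i j [i' j'] /= -> -> ->.
  rewrite !mem_diagram => /and4P[j1 _ _ _] h.
  by have := peak_part pb j1; lia.
move=> b b' /orP[/andP[/eqP rr cc]|/andP[cb rr]]; first exact: row_le.
have hb := valP b; have hb' := valP b'.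
have box_at i j : (i, j) \in diagram alpha ->
    exists2 d : box alpha, col d = i & row d = j.
  by case/box_of_mem => d vd; exists d; rewrite /col /row vd.
(* With [b] in row j and [b'] in a higher row j', the path runs through (2, j), (1, j + 1) and (1,
   j'). Row j is not the last one, so it has a second box. *)
have [|b2 cb2 rb2] := box_at 2 (row b).
  move: rr hb hb'; rewrite /row; case: (val b) (val b') => i j [i' j'] /=.
  by have := peak_part (j := j) peak_alpha; rewrite !mem_diagram; lia.
have [|b3 cb3 rb3] := box_at 1 (row b).+1.
  move: rr hb hb'; rewrite /row; case: (val b) (val b') => i j [i' j'] /=.
  by have := part_gt0 (j := j.+1) peak_alpha; rewrite !mem_diagram; lia.
have [|b4 cb4 rb4] := box_at 1 (row b').
  by move: hb'; rewrite /row; case: (val b') => i' j'; rewrite !mem_diagram /=; lia.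
apply: (@leq_trans (T b2)); first by apply: row_le; rewrite ?cb2.
apply: (@leq_trans (T b3)); first by apply: peak_le; rewrite ?rb3 ?rb2.
apply: (@leq_trans (T b4)); first by apply: col_le; rewrite ?rb3 ?rb4.
apply: row_le; rewrite // cb4 /col.
by move: hb'; case: (val b') => i' j'; rewrite mem_diagram => /and4P[].
Qed.

Lemma min_SPIT : injective T ->
  (forall b b', below (val b) (val b') -> T b <= T b') -> is_SPIT T.
Proof.
move=> TI le; apply/and4P; split.
- by rewrite each_entry_onceE; apply/injectiveP.
- apply/'forall_'forall_implyP => b b' /andP[/eqP rr cc].
  rewrite /entry ltnS ltn_neqAle le ?andbT.
    by apply: contraTneq cc => /val_inj /TI ->; rewrite ltnn.
  by move: rr cc; rewrite /row /col /below => ->; rewrite eqxx => /ltnW ->.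
- apply/'forall_'forall_implyP => b b' /and3P[/eqP c1 /eqP c1' rr].
  rewrite /entry ltnS ltn_neqAle le ?andbT.
    by apply: contraTneq rr => /val_inj /TI ->; rewrite ltnn.
  by move: c1 rr; rewrite /row /col /below => -> ->; rewrite orbT.
apply/allP => k; rewrite mem_iota => kn.
have {}kn : k <= n by lia.
(* The boxes with entry at most [k], as a predicate on all pairs; the inequality is strict because
   [T] stores entries shifted by one. *)
pose D c := [exists b : box alpha, (val b == c) && (T b < k)].
have DE b : D (val b) = (T b < k).
  apply/existsP/idP => [[b' /andP[/eqP /val_inj -> //]]|h].
  by exists b; rewrite eqxx.
have D_up c d : c \in diagram alpha -> d \in diagram alpha ->
    below c d -> D d -> D c.
  move=> /box_of_mem[b <-] /box_of_mem[b' <-] /le; rewrite !DE.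
  exact: leq_ltn_trans.
(* Bijectivity of [T] puts exactly [k] boxes into [D], so the resulting peak composition has sum
   [k]. *)
have cD : count D (diagram alpha) = k.
  rewrite -card_box_pred -[RHS](card_ord_lt kn).
  rewrite -(@on_card_preimset _ _ T); last first.
    by apply/onW_bij/inj_card_bij => //; rewrite card_box_ord.
  by apply: eq_card => b; rewrite !inE DE.
have [beta pb eb] := subdiagramP peak_alpha D_up.
apply/upto_is_peakP => //; exists beta; first by rewrite -cD.
move=> c; rewrite eb inE; have [cA|cA] := boolP (c \in diagram alpha).
  by have [b <-] := box_of_mem cA; rewrite mem_boxes_upto DE.
by apply: contraNF cA => /mapP[b _ ->]; exact: valP.
Qed.

Lemma is_SPITE : is_SPIT T =
  (T \in heaps n (@subtree alpha) (seq_sub_enum (diagram alpha))).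
Proof.
apply/idP/heapsP => [sT|[TI le]]; last exact: min_SPIT.
split; last exact: SPIT_min.
by case/and4P: sT; rewrite each_entry_onceE => /injectiveP.
Qed.

End Characterization.

(** * The count, first without division and then as a quotient *)

Theorem card_SPIT n alpha : is_peak_composition n alpha ->
  #|SPIT n alpha| * \prod_(c <- diagram alpha) peak_hook alpha c = n`!.
Proof.
(* With [n] boxes, the injective fillings are the [n]! bijections. *)
move=> pa; have <- : n ^_ #|box alpha| = n`! by rewrite -(card_box_ord pa) card_ord ffactnn.
rewrite -(@card_heaps _ _ (@subtree alpha) (seq_sub_enum (diagram alpha))).
- congr (_ * _); first by apply: eq_card => T; rewrite inE is_SPITE.
  rewrite -[in LHS]map_val_seq_sub_enum big_map.
  by apply: eq_bigr => b _; rewrite card_subtree.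
- by move=> b; rewrite inE /below eqxx leqnn.
apply: (@sub_pairwise _ (relpre val lex)); first exact: lex_parents_first.
by rewrite -pairwise_map map_val_seq_sub_enum pairwise_lex_diagram.
Qed.

Local Open Scope ring_scope.

Theorem proposition5p1 (n : nat) (alpha : seq nat) :
  is_peak_composition n alpha ->
  #|SPIT n alpha|%:R = n`!%:R / (\prod_(c <- diagram alpha) peak_hook alpha c)%N%:R :> rat.
Proof.
move=> /card_SPIT card_eq.
(* The product of the hooks is a factor of [n]!, which is positive. *)
have hooks0 : (\prod_(c <- diagram alpha) peak_hook alpha c)%N%:R != 0 :> rat.
  rewrite Num.Theory.pnatr_eq0; apply: contraTneq (fact_gt0 n) => p0.
  by rewrite -card_eq p0 muln0.
by rewrite -card_eq natrM mulfK.
Qed.
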